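(* Let $n\ge 1$ and let $\mathrm{Fl} = \{\mathrm{fl}_1,\dots,\mathrm{fl}_n\}$ and $\mathrm{R} = \{\mathrm{r}_0,\dots,\mathrm{r}_n\}$ be tuples of functions which round to nearest in a perfect floating point system with unit roundoff $u$. If $20 n u\leq 1$ and $\mathbf{x},\mathbf{y}\in\mathbb{R}^{n+1}$, then $$\left| \mathrm{dot}_{\mathrm{Fl},\mathrm{R}}\left(\sum_{k=0}^n x_k y_k\right) - \sum_{k=0}^n x_k y_k\right| \leq \beta_n u\sum_{k=0}^n |x_k y_k| \leq (n+1)u\sum_{k=0}^n |x_k y_k|,$$ where $$\beta_n := \frac{n+1+3nu}{1+(n+1)u+nu^2} \leq \frac{n+1}{1+nu/2} \quad\text{and}\quad \beta_n\leq\frac{n+1}{1+(n-3)u}.$$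
   Context: Let $\beta \ge 2$ be an integer (the base; not to be confused with the numbers $\beta_n$ of the claim) and $\mu \ge 1$ an integer. The unit roundoff is $u := 1/(2\beta^{\mu})$. For $e\in\mathbb{Z}$ let $\mathcal{E}_e := \{\beta^e(\beta^\mu + r) : r = 0,1,\dots,(\beta-1)\beta^\mu - 1\}$. The perfect floating point system associated to $\beta,\mu$ is $\mathcal{P} := \{0\} \cup \bigcup_{e\in\mathbb{Z}} (\mathcal{E}_e \cup -\mathcal{E}_e)$. A function $\mathrm{fl}:\mathbb{R}\to\mathbb{R}$ rounds to nearest in a system $\mathcal{F}$ if for all $z\in\mathbb{R}$ one has $\mathrm{fl}(z)\in\mathcal{F}$ and $|\mathrm{fl}(z)-z|\le|x-z|$ for all $x\in\mathcal{F}$ (ties may be broken arbitrarily). A tuple rounds to nearest in $\mathcal{F}$ if each of its elements does (the elements may differ). Floating point sum: for real $p_0,\dots,p_n$, put $\hat s_1 := \mathrm{fl}_1(p_0+p_1)$ and $\hat s_k := \mathrm{fl}_k(\hat s_{k-1}+p_k)$ for $2\le k\le n$. Then $\mathrm{Fl}\left(\sum_{k=0}^n p_k\right) := \hat s_n$. Floating point dot product: $\mathrm{dot}_{\mathrm{Fl},\mathrm{R}}\left(\sum_{k=0}^n x_ky_k\right) := \mathrm{Fl}\left(\sum_{k=0}^n \mathrm{r}_k(x_ky_k)\right)$. *)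

(* Defs.v *)
From HB Require Import structures.
From mathcomp Require Import all_boot all_order all_algebra.
From mathcomp Require Import boolp classical_sets reals.

Set Implicit Arguments.
Unset Strict Implicit.
Unset Printing Implicit Defensive.

Import Order.TTheory GRing.Theory Num.Theory.

Local Open Scope classical_set_scope.
Local Open Scope ring_scope.

Definition unit_roundoff (R : realType) (beta mu : nat) : R :=
  1 / (2 * beta%:R ^+ mu).

Definition binade (R : realType) (beta mu : nat) (e : int) : set R :=
  [set beta%:R ^ e * (beta%:R ^+ mu + r%:R) |
     r in [set r : nat | (r < (beta - 1) * beta ^ mu)%N]].

Definition perfect_system (R : realType) (beta mu : nat) : set R :=
  [set 0] `|`
  \bigcup_(e : int) (binade beta mu e `|` [set - x | x in binade beta mu e]).

Definition rounds_to_nearest (R : realType) (F : set R) (fl : R -> R) : Prop :=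
  forall z : R, F (fl z) /\ (forall x : R, F x -> `|fl z - z| <= `|x - z|).

(* The tuple (fl_1, ..., fl_n) is indexed from 0: [fl i] is fl_{i+1}, so that
   [fl ord_max] is the last rounding fl_n.  For n = 0 no rounding takes place
   and the value is p_0; hence for n = 1 the value is fl_1 (p_0 + p_1). *)
Fixpoint fl_sum (R : realType) (n : nat) :
    ('I_n -> R -> R) -> ('I_n.+1 -> R) -> R :=
  match n with
  | 0 => fun _ p => p ord0
  | m.+1 => fun fl p =>
      fl ord_max
        (fl_sum (fun i : 'I_m => fl (widen_ord (leqnSn m) i))
                (fun i : 'I_m.+1 => p (widen_ord (leqnSn m.+1) i))
         + p ord_max)
  end.

Definition fl_dot (R : realType) (n : nat) (fl : 'I_n -> R -> R)
    (r : 'I_n.+1 -> R -> R) (x y : 'rV[R]_n.+1) : R :=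
  fl_sum fl (fun k => r k (x 0 k * y 0 k)).

(* The constant written beta_n; unrelated to the base beta. *)
Definition dot_const (R : realType) (n : nat) (u : R) : R :=
  (n%:R + 1 + 3 * n%:R * u) / (1 + (n%:R + 1) * u + n%:R * u ^+ 2).

(* Main.v *)
Require Import Defs.
From mathcomp Require Import all_boot all_order all_algebra.
From mathcomp Require Import boolp classical_sets reals.
From mathcomp Require Import ring lra.

Import Order.TTheory GRing.Theory Num.Theory.

Local Open Scope ring_scope.

(** Write [u] for the unit roundoff, [s] for the computed sum of [p_0, ..., p_n],
    [S] for the exact sum, [A] for the sum of the [`|p_k|], and let the rounding
    errors be [delta_k = `|fl_k z_k - z_k|] with [z_k] the argument of the k-th
    rounding.

    The heart of the matter is the summation bound
    [`|s - S| <= n u / (1 + n u) * A] ([fl_sum_error]).  Three facts about one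
    rounding suffice.  If [w] is a power of the base, then
    - [delta_k <= u w] when [`|z_k| < beta w] ([round_err_le_ufp]);
    - [delta_k <= `|z_k| - w] when [w <= `|z_k|], since [w] and [- w] are
      floating point numbers ([round_err_le_excess]);
    - [delta_k <= `|p_k|] when the previous partial sum is a floating point
      number ([round_err_le_addend]).

    Let [w] be the largest power of the base below some [`|z_k|], and let [k] be
    the first index with [w <= `|z_k|].  The errors before [k] occur in lower
    binades, so each is at most [u w / beta <= u w / 2]; call [d] a bound for
    their total, with [2 d <= (k - 1) u w].  At step [k] the second fact gives
    [w + delta_k - d] as a lower bound for the sum of the [`|p_j|], [j <= k].
    After [k], an error [delta_j] is paid for by [`|p_j|].  Hence the total error
    [D] satisfies both [D <= n u w - d] and [A >= w + D - 2 d], and these two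
    inequalities imply [(1 + n u) D <= n u A] as soon as [2 n u <= 1].  In the
    formal proof, [balanced_error] records these two inequalities for a prefix of
    the sum, and [w] is raised whenever a partial sum enters a higher binade, so
    that the maximum over [k] never has to be named.

    For the dot product, the second and first facts combine into
    [delta <= u / (1 + u) * `|z|] for the rounding of each product
    ([round_rel_err]).  Adding these errors to the one of the summation gives
    [n u / (1 + n u) * (1 + 2 u) / (1 + u) + u / (1 + u)], which is exactly
    [dot_const n u * u] ([fl_dot_error]).  The bounds on [dot_const] are polynomial
    inequalities in [n] and [u]. *)

(** * Binades and nearest rounding *)

Lemma base_ge2 (R : realType) (beta : nat) :
  (2 <= beta)%N -> (2 : R) <= beta%:R.
Proof. by rewrite ler_nat. Qed.

Lemma expz_base_gt0 (R : realType) (beta : nat) (e : int) :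
  (2 <= beta)%N -> (0 : R) < beta%:R ^ e.
Proof. by move=> /(@base_ge2 R) b2; apply: exprz_gt0; lra. Qed.

Lemma expz_baseD1 (R : realType) (beta : nat) (e : int) :
  (2 <= beta)%N -> beta%:R ^ (e + 1) = beta%:R * beta%:R ^ e :> R.
Proof.
move=> /(@base_ge2 R) b2; rewrite expfzDr ?expr1z 1?mulrC //.
by apply: lt0r_neq0; lra.
Qed.

Lemma le_binade (R : realType) (beta : nat) (e e' : int) :
  (2 <= beta)%N -> (beta%:R ^ e : R) < beta%:R ^ (e' + 1) ->
  (beta%:R ^ e : R) <= beta%:R ^ e'.
Proof.
move=> b2; have b1 : 1 < beta%:R :> R by rewrite ltr1n.
by rewrite ltr_eXz2l // ler_eXz2l // ltzD1.
Qed.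

Lemma expz_subK (R : realType) (beta mu : nat) (e : int) :
  (2 <= beta)%N -> beta%:R ^ (e - mu%:Z) * beta%:R ^+ mu = beta%:R ^ e :> R.
Proof.
move=> /(@base_ge2 R) b2; rewrite exprnP -expfzDr ?subrK //.
by apply: lt0r_neq0; lra.
Qed.

Lemma unit_roundoff_gt0 (R : realType) (beta mu : nat) :
  (2 <= beta)%N -> 0 < unit_roundoff R beta mu.
Proof.
move=> /(@base_ge2 R) b2; rewrite /unit_roundoff divr_gt0 // mulr_gt0 //.
by apply: exprn_gt0; lra.
Qed.

(** The binade starting at [beta ^ e] has spacing [beta ^ (e - mu)], and
    [u * beta ^ e] is half of it. *)
Lemma unit_roundoffM (R : realType) (beta mu : nat) (e : int) :
  (2 <= beta)%N ->
  unit_roundoff R beta mu * beta%:R ^ e = beta%:R ^ (e - mu%:Z) / 2.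
Proof.
move=> b2; rewrite -(expz_subK R beta mu e b2) /unit_roundoff.
have : beta%:R ^+ mu != 0 :> R.
  by apply/lt0r_neq0/exprn_gt0; have := base_ge2 R beta b2; lra.
by move: (beta%:R ^+ mu) (beta%:R ^ _) => q s q0; field.
Qed.

Lemma exists_binade (R : realType) (beta : nat) (x : R) :
  (2 <= beta)%N -> 0 < x ->
  exists e : int, beta%:R ^ e <= x /\ x < beta%:R ^ (e + 1).
Proof.
move=> b2 x0; have b2R := base_ge2 R beta b2.
have b0 : beta%:R != 0 :> R by apply: lt0r_neq0; lra.
(* Scaling by a large power of the base reduces to the integer logarithm of
   [truncn y], for [y >= 1]. *)
pose N := (Num.truncn x^-1).+1; pose y := x * beta%:R ^+ N.
have bN0 : 0 < beta%:R ^+ N :> R by apply: exprn_gt0; lra.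
have y1 : 1 <= y.
  rewrite /y -ler_pdivrMl // mulr1.
  apply: le_trans (ltW (truncnS_gt _)) _.
  by rewrite -natrX ler_nat ltnW // ltn_expl.
have y0 : 0 <= y by lra.
have ty0 : (0 < Num.truncn y)%N by rewrite truncn_ge_nat.
have /andP[lo hi] := trunc_log_bounds b2 ty0.
set k := trunc_log _ _ in lo hi.
have xE : x = y * beta%:R ^ (- N%:Z).
  by rewrite -exprnN mulfK // lt0r_neq0.
have dN0 : 0 < beta%:R ^ (- N%:Z) :> R by apply: expz_base_gt0.
exists (k%:Z - N%:Z); split.
  rewrite expfzDr // xE ler_pM2r // -exprnP -natrX.
  by rewrite -truncn_ge_nat.
rewrite addrAC expfzDr // xE ltr_pM2r // -PoszD -exprnP addn1 -natrX.
by apply: lt_le_trans (truncnS_gt _) _; rewrite ler_nat.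
Qed.

Lemma perfect_system0 (R : realType) (beta mu : nat) :
  perfect_system beta mu (0 : R).
Proof. by left. Qed.

Lemma perfect_systemN (R : realType) (beta mu : nat) (x : R) :
  perfect_system beta mu x -> perfect_system beta mu (- x).
Proof.
case=> [->|[e _ ex]]; first by rewrite oppr0; left.
right; exists e => //; case: ex => [bx|[y bY <-]]; last by left; rewrite opprK.
by right; exists x.
Qed.

Lemma perfect_system_binade (R : realType) (beta mu N : nat) (e : int) :
  (beta ^ mu <= N)%N -> (N < beta ^ mu.+1)%N ->
  perfect_system beta mu (beta%:R ^ e * N%:R : R).
Proof.
move=> lo hi; right; exists e => //; left.
exists (N - beta ^ mu)%N => /=.
  by rewrite mulnBl mul1n -expnS ltn_sub2r // (leq_ltn_trans lo).
by rewrite natrB // natrX addrC subrK.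
Qed.

Lemma perfect_system_pow (R : realType) (beta mu : nat) (e : int) :
  (2 <= beta)%N -> perfect_system beta mu (beta%:R ^ e : R).
Proof.
move=> b2; rewrite -(expz_subK R beta mu e b2) -natrX.
by apply: perfect_system_binade; rewrite ?ltn_exp2l.
Qed.

(** In units of the spacing, the binade consists of the integers of
    [[beta ^ mu, beta ^ mu.+1)]; rounding to the nearest integer moves by at most
    one half. *)
Lemma near_pos_perfect_system (R : realType) (beta mu : nat) (e : int) (z : R) :
  (2 <= beta)%N -> beta%:R ^ e <= z -> z < beta%:R ^ (e + 1) ->
  exists2 x, perfect_system beta mu x &
    `|x - z| <= unit_roundoff R beta mu * beta%:R ^ e.
Proof.
move=> b2 lo hi; rewrite unit_roundoffM //.
have s0 := expz_base_gt0 R beta (e - mu%:Z) b2.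
have eS := expz_subK R beta mu (e + 1) b2.
move: lo hi; rewrite expz_baseD1 // -(expz_subK R beta mu e b2).
set s := beta%:R ^ _ in s0 * => lo hi.
have [t zE] : exists t, z = s * t.
  by exists (z / s); rewrite mulrC divfK // lt0r_neq0.
have lo' : (beta ^ mu)%:R <= t by move: lo; rewrite zE ler_pM2l // natrX.
have hi' : t < (beta ^ mu.+1)%:R.
  by move: hi; rewrite zE [ltRHS]mulrCA ltr_pM2l // natrX exprS.
have t0 : 0 <= t by apply: le_trans lo'; rewrite ler0n.
have t0' : 0 <= t + 2^-1 by lra.
pose N := Num.truncn (t + 2^-1).
have /andP[N1 N2] : N%:R <= t + 2^-1 < N.+1%:R by apply: truncn_itv.
have Nlo : (beta ^ mu <= N)%N by rewrite /N truncn_ge_nat //; lra.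
have Nhi : (N <= beta ^ mu.+1)%N.
  rewrite -ltnS -(ltr_nat R) -[in ltRHS]natr1; lra.
exists (s * N%:R).
  (* [N] may round up to [beta ^ mu.+1], the first number of the next binade. *)
  move: Nhi; rewrite leq_eqVlt => /orP[/eqP->|Nhi]; last first.
    exact: perfect_system_binade.
  rewrite natrX exprS mulrCA (expz_subK R beta mu e b2) -expz_baseD1 //.
  exact: perfect_system_pow.
rewrite zE -mulrBr normrM (gtr0_norm s0) ler_pM2l //.
by move: N2; rewrite -[ltRHS]natr1 => N2; rewrite ler_norml; apply/andP; split; lra.
Qed.

Lemma near_perfect_system (R : realType) (beta mu : nat) (e : int) (z : R) :
  (2 <= beta)%N -> beta%:R ^ e <= `|z| -> `|z| < beta%:R ^ (e + 1) ->
  exists2 x, perfect_system beta mu x &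
    `|x - z| <= unit_roundoff R beta mu * beta%:R ^ e.
Proof.
move=> b2; case: (ger0P z) => z0; first exact: near_pos_perfect_system.
move=> lo hi; have [x Fx xz] := near_pos_perfect_system R beta mu e _ b2 lo hi.
exists (- x); first exact: perfect_systemN.
by rewrite distrC opprK addrC -[z]opprK.
Qed.

(** [s] itself is a candidate for the rounding of [s + p]. *)
Lemma round_err_le_addend (R : realType) (F : set R) (fl : R -> R) (s p : R) :
  rounds_to_nearest F fl -> F s -> `|fl (s + p) - (s + p)| <= `|p|.
Proof.
move=> hfl Fs; have [_ /(_ s Fs)] := hfl (s + p).
by rewrite opprD addNKr normrN.
Qed.

(** [beta ^ e], with the sign of [z], is a candidate for the rounding of [z]. *)
Lemma round_err_le_excess (R : realType) (beta mu : nat) (fl : R -> R)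
    (e : int) (z : R) :
  (2 <= beta)%N -> rounds_to_nearest (perfect_system beta mu) fl ->
  beta%:R ^ e <= `|z| -> `|fl z - z| <= `|z| - beta%:R ^ e.
Proof.
move=> b2 hfl; have [_ near] := hfl z.
have Fw := perfect_system_pow R beta mu e b2.
case: (ger0P z) => z0 lo; apply: le_trans.
- exact: near Fw.
- by rewrite ler0_norm; lra.
- exact: near (perfect_systemN _ _ _ _ Fw).
- by rewrite ger0_norm; lra.
Qed.

Lemma round_err_le_ufp (R : realType) (beta mu : nat) (fl : R -> R)
    (e : int) (z : R) :
  (2 <= beta)%N -> rounds_to_nearest (perfect_system beta mu) fl ->
  `|z| < beta%:R ^ (e + 1) ->
  `|fl z - z| <= unit_roundoff R beta mu * beta%:R ^ e.
Proof.
move=> b2 hfl hi; have [_ near] := hfl z.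
have u0 := unit_roundoff_gt0 R beta mu b2.
have [->|z0] := eqVneq z 0.
  rewrite subr0; have [_ /(_ 0)] := hfl 0.
  rewrite !subr0 normr0 => /(_ (perfect_system0 _ _ _)) /le_trans; apply.
  by rewrite mulr_ge0 ?ltW // expz_base_gt0.
have [e' [lo' hi']] : exists e' : int,
    beta%:R ^ e' <= `|z| /\ `|z| < beta%:R ^ (e' + 1).
  by apply: exists_binade; rewrite ?normr_gt0.
have [x Fx xz] := near_perfect_system R beta mu e' z b2 lo' hi'.
apply: le_trans (near x Fx) _; apply: le_trans xz _.
by rewrite ler_pM2l // le_binade // (le_lt_trans lo').
Qed.

(** With [w] the power of the base that starts the binade of [z], the error is at
    most [u w] and at most [`|z| - w]; weighting the second bound by [u] cancels
    [w].  This gains the factor [1 + u] over the crude bound [u * `|z|]. *)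
Lemma round_rel_err (R : realType) (beta mu : nat) (fl : R -> R) (z : R)
    (u := unit_roundoff R beta mu) :
  (2 <= beta)%N -> rounds_to_nearest (perfect_system beta mu) fl ->
  (1 + u) * `|fl z - z| <= u * `|z|.
Proof.
move=> b2 hfl; have u0 : 0 < u := unit_roundoff_gt0 R beta mu b2.
have [->|z0] := eqVneq z 0.
  have [_ /(_ 0 (perfect_system0 _ _ _))] := hfl 0.
  by rewrite !subr0 normr0 mulr0 => ?; rewrite pmulr_rle0 //; lra.
have [e [lo hi]] : exists e : int,
    beta%:R ^ e <= `|z| /\ `|z| < beta%:R ^ (e + 1).
  by apply: exists_binade; rewrite ?normr_gt0.
have := round_err_le_ufp _ _ _ _ _ _ b2 hfl hi.
have := round_err_le_excess _ _ _ _ _ _ b2 hfl lo.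
rewrite -/u; nra.
Qed.

(** * Recursive summation *)

(** With [w = beta ^ e] the leading power of the base reached by the arguments of
    the first [m] roundings, [D] bounds their total error and [d] the part of it
    committed before [w] was reached. *)
Definition balanced_error (R : realType) (beta mu m : nat) (s S A : R) : Prop :=
  exists (e : int) (D d : R),
    [/\ 0 <= d, `|s - S| <= D, beta%:R ^ e + D - 2 * d <= A &
        D + d <= m%:R * unit_roundoff R beta mu * beta%:R ^ e].

(** The sum reaches the binade of [w = beta ^ e] with an error [d] that is small
    on this scale.  The exact mass [A + `|p|] is then at least
    [`|s + p| - d >= w + delta - d], and the new total error is [D = d + delta]. *)
Lemma balanced_error_enter (R : realType) (beta mu m : nat) (fl : R -> R)
    (s S A p d : R) (e : int) :
  (2 <= beta)%N -> rounds_to_nearest (perfect_system beta mu) fl ->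
  `|S| <= A -> `|s - S| <= d ->
  2 * d <= m%:R * unit_roundoff R beta mu * beta%:R ^ e ->
  beta%:R ^ e <= `|s + p| -> `|s + p| < beta%:R ^ (e + 1) ->
  balanced_error R beta mu m.+1 (fl (s + p)) (S + p) (A + `|p|).
Proof.
move=> b2 hfl SA sS dw lo hi.
have d_ufp := round_err_le_ufp _ _ _ _ _ _ b2 hfl hi.
have d_exc := round_err_le_excess _ _ _ _ _ _ b2 hfl lo.
set z := s + p in lo hi d_ufp d_exc *.
have zA : `|z| <= d + A + `|p|.
  have -> : z = (s - S) + S + p by rewrite subrK.
  have := ler_normD (s - S + S) p; have := ler_normD (s - S) S; lra.
exists e, (d + `|fl z - z|), d; split.
- exact: le_trans (normr_ge0 _) sS.
- have -> : fl z - (S + p) = (s - S) + (fl z - z) by rewrite /z; ring.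
  have := ler_normD (s - S) (fl z - z); lra.
- lra.
- rewrite -natr1 -mulrA mulrDl mul1r mulrA; lra.
Qed.

(** As long as the sum does not go beyond the binade of [beta ^ e], the error
    [delta] of the step increases [D] by at most [u * beta ^ e], and [A] increases
    by [`|p| >= delta]. *)
Lemma balanced_error_stay (R : realType) (beta mu m : nat) (fl : R -> R)
    (s S A p D d : R) (e : int) :
  (2 <= beta)%N -> rounds_to_nearest (perfect_system beta mu) fl ->
  perfect_system beta mu s ->
  0 <= d -> `|s - S| <= D -> beta%:R ^ e + D - 2 * d <= A ->
  D + d <= m%:R * unit_roundoff R beta mu * beta%:R ^ e ->
  `|s + p| < beta%:R ^ (e + 1) ->
  balanced_error R beta mu m.+1 (fl (s + p)) (S + p) (A + `|p|).
Proof.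
move=> b2 hfl Fs d0 sS wA Dd hi.
have d_ufp := round_err_le_ufp _ _ _ _ _ _ b2 hfl hi.
have d_add := round_err_le_addend _ _ _ _ p hfl Fs.
set z := s + p in hi d_ufp d_add *.
exists e, (D + `|fl z - z|), d; split => //.
- have -> : fl z - (S + p) = (s - S) + (fl z - z) by rewrite /z; ring.
  have := ler_normD (s - S) (fl z - z); lra.
- lra.
- rewrite -natr1 -mulrA mulrDl mul1r mulrA; lra.
Qed.

(** The first alternative holds initially, where [s = p_0] need not be a floating
    point number, and as long as only zeros have been rounded. *)
Definition summation_state (R : realType) (beta mu m : nat) (s S A : R) : Prop :=
  s = S \/ (perfect_system beta mu s /\ balanced_error R beta mu m s S A).

Lemma summation_state_step (R : realType) (beta mu m : nat) (fl : R -> R)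
    (s S A p : R) :
  (2 <= beta)%N -> rounds_to_nearest (perfect_system beta mu) fl ->
  `|S| <= A -> summation_state R beta mu m s S A ->
  summation_state R beta mu m.+1 (fl (s + p)) (S + p) (A + `|p|).
Proof.
move=> b2 hfl SA st; have u0 := unit_roundoff_gt0 R beta mu b2.
have b2R := base_ge2 R beta b2.
have [Ffl near] := hfl (s + p).
have m0 : (0 : R) <= m%:R by [].
case: st => [sS|[Fs [e [D [d [d0 sS wA Dd]]]]]].
  have [z0|z0] := eqVneq (s + p) 0.
    left; move: near => /(_ 0 (perfect_system0 _ _ _)).
    by rewrite -sS z0 !subr0 normr0 normr_le0 => /eqP.
  have [e [lo hi]] : exists e : int,
      beta%:R ^ e <= `|s + p| /\ `|s + p| < beta%:R ^ (e + 1).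
    by apply: exists_binade; rewrite ?normr_gt0.
  right; split => //.
  apply: (balanced_error_enter _ _ _ _ _ _ _ _ _ 0 e) => //.
    by rewrite sS subrr normr0.
  rewrite mulr0; apply: mulr_ge0; last exact: ltW (expz_base_gt0 _ _ _ b2).
  by rewrite mulr_ge0 // ltW.
right; split => //.
have [hi|lo] := ltP `|s + p| (beta%:R ^ (e + 1)).
  exact: (balanced_error_stay _ _ _ _ _ _ _ _ _ D d e).
have w0 := expz_base_gt0 R beta e b2.
have z0 : 0 < `|s + p|.
  by apply: lt_le_trans lo; rewrite expz_base_gt0.
have [e' [lo' hi']] := exists_binade R beta _ b2 z0.
apply: (balanced_error_enter _ _ _ _ _ _ _ _ _ D e') => //.
(* In a higher binade all the previous error counts at most half: the new [d]
   is the old [D]. *)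
have ww' : 2 * beta%:R ^ e <= beta%:R ^ e' :> R.
  apply: (@le_trans _ _ (beta%:R ^ (e + 1))).
    by rewrite expz_baseD1 // ler_pM2r.
  exact: le_binade _ _ _ _ b2 (le_lt_trans lo hi').
have mu0 : 0 <= m%:R * unit_roundoff R beta mu by rewrite mulr_ge0 // ltW.
have := ler_wpM2l mu0 ww'; lra.
Qed.

Lemma fl_sum_state (R : realType) (beta mu n : nat)
    (fl : 'I_n -> R -> R) (p : 'I_n.+1 -> R) :
  (2 <= beta)%N ->
  (forall i, rounds_to_nearest (perfect_system beta mu) (fl i)) ->
  summation_state R beta mu n (fl_sum fl p) (\sum_k p k) (\sum_k `|p k|).
Proof.
move=> b2; elim: n fl p => [|n IH] fl p hfl; first by left; rewrite big_ord1.
rewrite [X in summation_state _ _ _ _ _ X]big_ord_recr.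
rewrite [X in summation_state _ _ _ _ _ _ X]big_ord_recr /=.
apply: summation_state_step => //; first exact: ler_norm_sum.
by apply: IH => i; apply: hfl.
Qed.

(** By [balanced_error], [n u A >= n u (w + D - 2 d)] and [n u w >= D + d], so
    [n u A - (1 + n u) D >= d - 2 n u d >= 0]. *)
Lemma fl_sum_error (R : realType) (beta mu n : nat)
    (fl : 'I_n -> R -> R) (p : 'I_n.+1 -> R) (u := unit_roundoff R beta mu) :
  (2 <= beta)%N ->
  (forall i, rounds_to_nearest (perfect_system beta mu) (fl i)) ->
  2 * n%:R * u <= 1 ->
  (1 + n%:R * u) * `|fl_sum fl p - \sum_k p k| <= n%:R * u * \sum_k `|p k|.
Proof.
move=> b2 hfl nu1.
have nu0 : 0 <= n%:R * u by rewrite mulr_ge0 // ltW // unit_roundoff_gt0.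
case: (fl_sum_state R beta mu n fl p b2 hfl) => [->|[_]].
  by rewrite subrr normr0 mulr0 mulr_ge0 // sumr_ge0.
move=> [e [D [d [d0 sS wA Dd]]]].
apply: (@le_trans _ _ ((1 + n%:R * u) * D)); first by rewrite ler_wpM2l //; lra.
apply: le_trans (ler_wpM2l nu0 wA).
have : 2 * (n%:R * u) * d <= d by rewrite ler_piMl //; lra.
move: Dd; rewrite -/u; lra.
Qed.

(** * The dot product *)

Lemma dot_const_denE (R : realType) (n : nat) (u : R) :
  1 + (n%:R + 1) * u + n%:R * u ^+ 2 = (1 + n%:R * u) * (1 + u).
Proof. by ring. Qed.

Lemma dot_const_den_gt0 (R : realType) (n : nat) (u : R) :
  0 < u -> 0 < 1 + (n%:R + 1) * u + n%:R * u ^+ 2.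
Proof.
move=> u0; have nu0 : 0 <= n%:R * u by rewrite mulr_ge0 // ltW.
by rewrite dot_const_denE mulr_gt0 //; lra.
Qed.

Lemma fl_dot_error (R : realType) (beta mu n : nat) (fl : 'I_n -> R -> R)
    (r : 'I_n.+1 -> R -> R) (x y : 'rV[R]_n.+1) (u := unit_roundoff R beta mu) :
  (2 <= beta)%N ->
  (forall i, rounds_to_nearest (perfect_system beta mu) (fl i)) ->
  (forall k, rounds_to_nearest (perfect_system beta mu) (r k)) ->
  2 * n%:R * u <= 1 ->
  `|fl_dot fl r x y - \sum_(k < n.+1) x 0 k * y 0 k|
     <= dot_const n u * u * \sum_(k < n.+1) `|x 0 k * y 0 k|.
Proof.
move=> b2 hfl hr nu1.
have u0 : 0 < u := unit_roundoff_gt0 R beta mu b2.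
pose q k := x 0 k * y 0 k; pose p k := r k (q k).
set A := \sum_k `|_|; pose B := \sum_k `|p k|; pose C := \sum_k `|p k - q k|.
have sumE : (1 + n%:R * u) * `|fl_sum fl p - \sum_k p k| <= n%:R * u * B.
  exact: fl_sum_error.
have CA : (1 + u) * C <= u * A.
  by rewrite !mulr_sumr ler_sum // => k _; apply: round_rel_err (hr k).
have BAC : B <= A + C.
  rewrite -big_split ler_sum //= => k _; rewrite addrC.
  by rewrite -{1}[p k](subrK (q k)) ler_normD.
have pq : `|\sum_k p k - \sum_k q k| <= C by rewrite -sumrB ler_norm_sum.
have tri := ler_normD (fl_sum fl p - \sum_k p k) (\sum_k p k - \sum_k q k).
rewrite addrA subrK in tri.
rewrite /fl_dot -/q; set T := `|fl_sum _ _ - _|.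
have {tri} TE : T <= `|fl_sum fl p - \sum_k p k| + C by apply: le_trans tri _; lra.
have nu0 : 0 <= n%:R * u by rewrite mulr_ge0 // ltW.
have den0 := dot_const_den_gt0 R n u u0; rewrite dot_const_denE in den0.
(* [n + 1 + 3 n u = n (1 + 2 u) + (1 + n u)] splits the bound into the share of
   the summation and that of the products. *)
have -> : dot_const n u * u * A = ((1 + n%:R * u) * (1 + u))^-1 *
    (n%:R * u * ((1 + 2 * u) * A) + (1 + n%:R * u) * (u * A)).
  by rewrite /dot_const dot_const_denE; ring.
rewrite ler_pdivlMl //.
move: sumE CA BAC TE nu0 den0 {pq}; move: (n%:R * u) T C B A => N T C B A.
move: `|_ - _| => E sumE CA BAC TE N0 den0.
have s1 : (1 + u) * ((1 + N) * E) <= (1 + u) * (N * B) by rewrite ler_wpM2l //; lra.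
have s2 : N * ((1 + u) * B) <= N * ((1 + 2 * u) * A).
  rewrite ler_wpM2l //; have := ler_wpM2l (_ : 0 <= 1 + u) BAC.
  by move=> /(_ ltac:(lra)); lra.
have s3 : (1 + N) * ((1 + u) * C) <= (1 + N) * (u * A) by rewrite ler_wpM2l //; lra.
have s4 : ((1 + N) * (1 + u)) * T <= ((1 + N) * (1 + u)) * (E + C).
  by rewrite ler_pM2l.
apply: le_trans s4 _.
lra.
Qed.

(** * The constant *)

Lemma dot_const_le_succ (R : realType) (n : nat) (u : R) :
  0 < u -> dot_const n u <= n%:R + 1.
Proof.
move=> u0; rewrite /dot_const ler_pdivrMr ?dot_const_den_gt0 //.
have n0 : (0 : R) <= n%:R by [].
rewrite -subr_ge0.
have -> : (n%:R + 1) * (1 + (n%:R + 1) * u + n%:R * u ^+ 2)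
    - (n%:R + 1 + 3 * n%:R * u)
  = (n%:R ^+ 2 - n%:R + 1) * u + (n%:R * (n%:R + 1)) * u ^+ 2 by ring.
by apply: addr_ge0; apply: mulr_ge0; [nra | lra | nra | apply: sqr_ge0].
Qed.

Lemma dot_const_le_half (R : realType) (n : nat) (u : R) :
  (1 <= n)%N -> 0 < u -> 2 * n%:R * u <= 1 ->
  dot_const n u <= (n%:R + 1) / (1 + n%:R * u / 2).
Proof.
move=> n1 u0 nu1; rewrite /dot_const.
have n0 : (0 : R) <= n%:R by [].
have nu0 : 0 <= n%:R * u by rewrite mulr_ge0 // ltW.
rewrite ler_pdivrMr ?dot_const_den_gt0 // [leRHS]mulrAC ler_pdivlMr; last by lra.
rewrite -subr_ge0.
set X := (X in 0 <= X).
(* For [n = 1] both factors are nonpositive, for [n >= 2] both are nonnegative. *)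
have -> : X = u / 2 * ((n%:R - 2) * (n%:R - 1 - n%:R * u)) by rewrite /X; field.
rewrite mulr_ge0 //; first lra.
case: n n1 {X} n0 nu0 nu1 => [//|[|n]] _ n0 nu0 nu1.
  by have -> : (1 - 2) * (1 - 1 - 1 * u) = u by [ring]; exact: ltW.
have n2 : (2 : R) <= n.+2%:R by rewrite ler_nat.
by apply: mulr_ge0; lra.
Qed.

Lemma dot_const_le_shift (R : realType) (n : nat) (u : R) :
  (1 <= n)%N -> 0 < u -> 3 * n%:R * u <= 1 ->
  dot_const n u <= (n%:R + 1) / (1 + (n%:R - 3) * u).
Proof.
move=> n1 u0 nu1; rewrite /dot_const.
have n1R : (1 : R) <= n%:R by rewrite ler1n.
have un : u <= n%:R * u by rewrite ler_peMl // ltW.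
rewrite ler_pdivrMr ?dot_const_den_gt0 // [leRHS]mulrAC ler_pdivlMr; last lra.
rewrite -subr_ge0.
set X := (X in 0 <= X).
have -> : X = u * (n%:R + 4 + 10 * (n%:R * u) - 2 * (n%:R * (n%:R * u))).
  by rewrite /X; ring.
have nnu : n%:R * (3 * n%:R * u) <= n%:R by rewrite ler_piMr.
by apply: mulr_ge0; lra.
Qed.

Theorem corollary10 (R : realType) (beta mu n : nat) (u : R)
    (fl : 'I_n -> R -> R) (r : 'I_n.+1 -> R -> R) (x y : 'rV[R]_n.+1)
    (hbeta : (2 <= beta)%N) (hmu : (1 <= mu)%N) (hn : (1 <= n)%N)
    (hu : u = unit_roundoff R beta mu)
    (hfl : forall i : 'I_n, rounds_to_nearest (perfect_system beta mu) (fl i))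
    (hr : forall k : 'I_n.+1, rounds_to_nearest (perfect_system beta mu) (r k))
    (hnu : 20 * n%:R * u <= 1) :
  [/\ `|fl_dot fl r x y - \sum_(k < n.+1) x 0 k * y 0 k|
        <= dot_const n u * u * \sum_(k < n.+1) `|x 0 k * y 0 k|,
      dot_const n u * u * (\sum_(k < n.+1) `|x 0 k * y 0 k|)
        <= (n%:R + 1) * u * \sum_(k < n.+1) `|x 0 k * y 0 k|,
      dot_const n u <= (n%:R + 1) / (1 + n%:R * u / 2) &
      dot_const n u <= (n%:R + 1) / (1 + (n%:R - 3) * u)].
Proof.
have u0 : 0 < u by rewrite hu unit_roundoff_gt0.
have nu0 : 0 <= n%:R * u by rewrite mulr_ge0 // ltW.
have nu2 : 2 * n%:R * u <= 1 by lra.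
have nu3 : 3 * n%:R * u <= 1 by lra.
split.
- by rewrite hu; apply: fl_dot_error => //; rewrite -hu.
- by rewrite ler_wpM2r ?sumr_ge0 // ler_pM2r // dot_const_le_succ.
- exact: dot_const_le_half.
- exact: dot_const_le_shift.
Qed.
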